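(* Let $\dot{H}$ be a totally disconnected graph of order $s$, and let $\dot{\mathscr{B}}_m$ be the maximal signed bipartite graph with $\dot{H}$ as a star complement for an eigenvalue $\mu$. If $\mu^2=1$, then $\dot{\mathscr{B}}_m\cong^s (sK_2,\emptyset)$.
   Context: A signed graph is a pair $(G,\Sigma^-)$ where $G$ is a finite simple graph (the underlying graph) and $\Sigma^-\subseteq E(G)$ is its set of negative edges; its adjacency matrix has entry $1$ for positive edges, $-1$ for negative edges and $0$ otherwise; its eigenvalues are those of this matrix. It is bipartite if $G$ is. The totally disconnected (signed) graph of order $s$ is $(sK_1,\emptyset)$, with $s$ vertices and no edges. If $\mu$ is an eigenvalue of a signed graph $(G,\Sigma^-)$ of multiplicity $k$, a star set for $\mu$ is a set $S\subseteq V(G)$ with $|S|=k$ such that $\mu$ is not an eigenvalue of the induced signed subgraph $(G,\Sigma^-)-S$; then $(G,\Sigma^-)-S$ is called a star complement for $\mu$ in $(G,\Sigma^-)$. ''Maximal'' means: of maximum order among all signed bipartite graphs with $\dot{H}$ as a star complement for $\mu$. Two signed graphs are isomorphic if their adjacency matrices satisfy $A_2=P^{-1}A_1P$ for a permutation matrix $P$, and switching equivalent if $A_2=D^{-1}A_1D$ for a diagonal matrix $D$ with diagonal entries $\pm1$. They are switching isomorphic, written $\cong^s$, if one is isomorphic to a signed graph switching equivalent to the other. $(sK_2,\emptyset)$ is the disjoint union of $s$ positive edges. *)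

(* Defs.v *)
(* MathComp *)
From mathcomp Require Import all_boot all_order all_fingroup all_algebra.

Set Implicit Arguments.
Unset Strict Implicit.
Unset Printing Implicit Defensive.

Import GRing.Theory Num.Theory.
Local Open Scope ring_scope.

(* The edge set E(G) and the set of negative edges are given as symmetric
   relations; [sg_neg_sub] says that negative edges are edges. *)
Record sgraph := SGraph {
  sg_vertex : finType;
  sg_adj : rel sg_vertex;
  sg_neg : rel sg_vertex;
  sg_adj_sym : symmetric sg_adj;
  sg_adj_irr : irreflexive sg_adj;
  sg_neg_sym : symmetric sg_neg;
  sg_neg_sub : subrel sg_neg sg_adj
}.

Definition sg_order (G : sgraph) : nat := #|sg_vertex G|.

Definition sg_entry (R : nzRingType) (G : sgraph) (x y : sg_vertex G) : R :=
  if sg_adj x y then (if sg_neg x y then -1 else 1) else 0.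

Definition adjmx (R : nzRingType) (G : sgraph) : 'M[R]_(sg_order G) :=
  \matrix_(i, j) sg_entry R (enum_val i) (enum_val j).

Definition bipartite (G : sgraph) : Prop :=
  exists c : sg_vertex G -> bool, forall x y, sg_adj x y -> c x != c y.

Section Delete.
Variables (G : sgraph) (S : {set sg_vertex G}).

Definition del_vertex : finType := {x : sg_vertex G | x \notin S}.
Definition del_adj : rel del_vertex := fun x y => sg_adj (val x) (val y).
Definition del_neg : rel del_vertex := fun x y => sg_neg (val x) (val y).

Fact del_adj_sym : symmetric del_adj.
Proof. by move=> x y; apply: sg_adj_sym. Qed.
Fact del_adj_irr : irreflexive del_adj.
Proof. by move=> x; apply: sg_adj_irr. Qed.
Fact del_neg_sym : symmetric del_neg.
Proof. by move=> x y; apply: sg_neg_sym. Qed.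
Fact del_neg_sub : subrel del_neg del_adj.
Proof. by move=> x y; apply: sg_neg_sub. Qed.

(* The induced signed subgraph G - S *)
Definition sg_delete : sgraph :=
  SGraph del_adj_sym del_adj_irr del_neg_sym del_neg_sub.

End Delete.

(* The [castmx] only identifies the two (equal) orders.  All the matrices are
   integral, and so are the inverses of P and D below. *)
Definition isomorphic (G1 G2 : sgraph) : Prop :=
  exists (e : sg_order G1 = sg_order G2) (P : 'M[int]_(sg_order G2)),
    is_perm_mx P /\
    adjmx int G2 = invmx P *m castmx (e, e) (adjmx int G1) *m P.

Definition switching_equivalent (G1 G2 : sgraph) : Prop :=
  exists (e : sg_order G1 = sg_order G2) (d : 'rV[int]_(sg_order G2)),
    (forall i, d 0 i = 1 \/ d 0 i = -1) /\
    adjmx int G2 =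
      invmx (diag_mx d) *m castmx (e, e) (adjmx int G1) *m diag_mx d.

Definition switching_isomorphic (G1 G2 : sgraph) : Prop :=
  exists G : sgraph, isomorphic G1 G /\ switching_equivalent G G2.

(* The adjacency matrix is symmetric, so the multiplicity of an eigenvalue is
   the dimension of its eigenspace. *)
Definition multiplicity (R : rcfType) (G : sgraph) (mu : R) : nat :=
  \rank (eigenspace (adjmx R G) mu).

Definition star_set (R : rcfType) (G : sgraph) (mu : R)
    (S : {set sg_vertex G}) : Prop :=
  [/\ eigenvalue (adjmx R G) mu,
      #|S| = multiplicity G mu
    & ~~ eigenvalue (adjmx R (sg_delete S)) mu].

Definition has_star_complement (R : rcfType) (G H : sgraph) (mu : R) : Prop :=
  exists2 S : {set sg_vertex G}, star_set mu S & isomorphic (sg_delete S) H.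

Definition maximal_bipartite (R : rcfType) (H : sgraph) (mu : R)
    (B : sgraph) : Prop :=
  [/\ bipartite B,
      has_star_complement B H mu
    & forall B' : sgraph, bipartite B' -> has_star_complement B' H mu ->
        (sg_order B' <= sg_order B)%N].

Section StandardGraphs.
Variable s : nat.

Definition norel (T : Type) : rel T := fun _ _ => false.
Definition matching : rel ('I_s * bool) :=
  fun x y => (x.1 == y.1) && (x.2 != y.2).

Fact norel_sym (T : Type) : symmetric (@norel T). Proof. by []. Qed.
Fact norel_irr (T : Type) : irreflexive (@norel T). Proof. by []. Qed.
Fact norel_sub (T : Type) (r : rel T) : subrel (@norel T) r.
Proof. by []. Qed.
Fact matching_sym : symmetric matching.
Proof. by move=> x y; rewrite /matching (eq_sym x.1) (eq_sym x.2). Qed.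
Fact matching_irr : irreflexive matching.
Proof. by move=> x; rewrite /matching !eqxx. Qed.

(* (sK_1, set0) *)
Definition sK1 : sgraph :=
  SGraph (@norel_sym 'I_s) (@norel_irr 'I_s) (@norel_sym 'I_s)
    (@norel_sub 'I_s (@norel 'I_s)).

(* (sK_2, set0): the i-th copy of K_2 joins (i, false) to (i, true) *)
Definition sK2 : sgraph :=
  SGraph matching_sym matching_irr (@norel_sym ('I_s * bool)%type)
    (@norel_sub ('I_s * bool)%type matching).

End StandardGraphs.

(* Main.v *)
Require Import Defs.
From mathcomp Require Import all_boot all_order all_fingroup all_algebra.

Set Implicit Arguments.
Unset Strict Implicit.
Unset Printing Implicit Defensive.

Import GRing.Theory Num.Theory.
Local Open Scope ring_scope.

(** Let [S] be a star set of a bipartite [B] whose complement [T] carries no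
    edge, and let [N] be the block of the adjacency matrix with rows in [S] and
    columns in [T].  An eigenvector for [mu <> 0] that vanishes on [S] vanishes
    on [T], so restriction to [S] is injective on the eigenspace; as [#|S|] is
    the multiplicity, it is bijective, and each unit vector on [S] extends to
    an eigenvector.  Writing out the eigenvector equations gives
    [mu ^+ 2 * I = mu * A_S + N N^T] ([star_reconstruction]).

    Let [mu ^+ 2 = 1].  The diagonal entries say that every vertex of [S] has
    exactly one neighbour in [T].  The other entries say that two vertices of
    [S] are adjacent exactly when these neighbours coincide, which would create
    a triangle.  In a bipartite graph, therefore, [S] is independent and is
    matched injectively into [T] ([star_matching]); in particular
    [#|S| <= #|T| = s].

    Conversely [sK2 s] has [sK1 s] as a star complement for [mu] when [0 < s]
    ([has_star_complement_sK2]), so a maximal [B] has at least [2 * s]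
    vertices.  Hence [#|S| = s] and [B] is a perfect matching with signs;
    switching at the [T]-ends of its negative edges makes every edge positive
    ([switching_signed_sK2]). *)

(** * Independent sets and adjacency entries *)

(** No edge joins two vertices of [T]. *)
Definition independent (G : sgraph) (T : {set sg_vertex G}) : Prop :=
  {in T &, forall x y, ~~ sg_adj x y}.

Section Entries.
Variables (R : nzRingType) (G : sgraph).
Implicit Types x y : sg_vertex G.

Lemma sg_entry_nadj x y : ~~ sg_adj x y -> sg_entry R x y = 0.
Proof. by rewrite /sg_entry => /negPf ->. Qed.

Lemma sg_entryC x y : sg_entry R x y = sg_entry R y x.
Proof. by rewrite /sg_entry sg_adj_sym sg_neg_sym. Qed.

Lemma sg_entry_sqr x y : sg_entry R x y * sg_entry R x y = (sg_adj x y)%:R.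
Proof.
rewrite /sg_entry; case: sg_adj; last by rewrite mulr0.
by case: sg_neg; rewrite ?mulrNN mulr1.
Qed.

Lemma sg_entry_eq0 x y : (sg_entry R x y == 0) = ~~ sg_adj x y.
Proof.
rewrite /sg_entry; case: sg_adj; last by rewrite eqxx.
by case: sg_neg; rewrite ?oppr_eq0 oner_eq0.
Qed.

Lemma adjmx_rank x y :
  adjmx R G (enum_rank x) (enum_rank y) = sg_entry R x y.
Proof. by rewrite mxE !enum_rankK. Qed.

Lemma adjmx_eq0 : adjmx R G = 0 <-> forall x y, ~~ sg_adj x y.
Proof.
split=> [A0 x y | nadj]; first by rewrite -sg_entry_eq0 -adjmx_rank A0 mxE.
by apply/matrixP => i j; rewrite !mxE sg_entry_nadj.
Qed.

End Entries.

(** * Eigenvectors and star sets *)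

Section StarSets.
Variables (R : fieldType) (G : sgraph).
Implicit Type S : {set sg_vertex G}.

(** Right multiplication by [restrict_mx S] restricts a row vector indexed by
    the vertices of [G] to its coordinates in [S]. *)
Definition restrict_mx S : 'M[R]_(sg_order G, #|S|) :=
  \matrix_(i, j) (i == enum_rank (enum_val j))%:R.

Lemma mul_restrict_mx m S (A : 'M_(m, sg_order G)) i j :
  (A *m restrict_mx S) i j = A i (enum_rank (enum_val j)).
Proof.
rewrite mxE (bigD1 (enum_rank (enum_val j))) //= mxE eqxx mulr1 big1 ?addr0 //.
by move=> k /negPf nk; rewrite mxE nk mulr0.
Qed.

(** The eigenvector equations, indexed by the vertices rather than by their
    ranks in the enumeration. *)
Lemma eigenspace_sgP (mu : R) (v : 'rV_(sg_order G)) :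
  (v <= eigenspace (adjmx R G) mu)%MS <->
  forall y, \sum_x v 0 (enum_rank x) * sg_entry R x y
            = mu * v 0 (enum_rank y).
Proof.
have mulE y : (v *m adjmx R G) 0 (enum_rank y)
              = \sum_x v 0 (enum_rank x) * sg_entry R x y.
  rewrite mxE (reindex enum_rank) /=; last exact/onW_bij/enum_rank_bij.
  by apply: eq_bigr => x _; rewrite adjmx_rank.
split=> [/eigenspaceP vA y | vA]; first by rewrite -mulE vA mxE.
apply/eigenspaceP/rowP => i.
by rewrite -(enum_valK i) mulE vA mxE.
Qed.

Variables (S : {set sg_vertex G}) (mu : R).
Hypotheses (mu_neq0 : mu != 0) (indS : independent (~: S)).

(** An eigenvector that vanishes on [S] vanishes on the independent set [~: S]
    too, because there [mu] times its value is a sum over neighbours in [S]. *)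
Lemma rank_restrict_eigenspace :
  \rank (eigenspace (adjmx R G) mu *m restrict_mx S)
  = \rank (eigenspace (adjmx R G) mu).
Proof.
rewrite -[RHS](mxrank_mul_ker _ (restrict_mx S)).
suff -> : (eigenspace (adjmx R G) mu :&: kermx (restrict_mx S))%MS = 0.
  by rewrite mxrank0 addn0.
apply/eqP/rowV0P => v; rewrite sub_capmx => /andP[/eigenspace_sgP vA].
move=> /sub_kermxP vS0.
have v0 x : x \in S -> v 0 (enum_rank x) = 0.
  move=> xS; have := mul_restrict_mx v 0 (enum_rank_in xS x).
  by rewrite vS0 mxE enum_rankK_in.
apply/rowP => i; rewrite [RHS]mxE -(enum_valK i).
have [/v0 //|niS] := boolP (enum_val i \in S).
apply: (mulfI mu_neq0); rewrite mulr0 -vA big1 // => x _.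
have [/v0 -> |nxS] := boolP (x \in S); first by rewrite mul0r.
by rewrite sg_entry_nadj ?mulr0 //; apply: indS; rewrite inE.
Qed.

(** The entries of [mu ^+ 2 * I = mu * A_S + N N^T]: the case of an edgeless
    star complement in the reconstruction theorem for star sets. *)
Lemma star_reconstruction :
  #|S| = \rank (eigenspace (adjmx R G) mu) ->
  {in S &, forall x y, mu ^+ 2 * (x == y)%:R
    = mu * sg_entry R x y + \sum_(t in ~: S) sg_entry R x t * sg_entry R t y}.
Proof.
move=> cardS x y xS yS.
have: row_full (eigenspace (adjmx R G) mu *m restrict_mx S).
  by rewrite /row_full rank_restrict_eigenspace cardS.
move=> /row_fullP [C CE].
(* the eigenvector whose restriction to S is the unit vector at x *)
pose v := row (enum_rank_in xS x) C *m eigenspace (adjmx R G) mu.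
have vE z : z \in S -> v 0 (enum_rank z) = (x == z)%:R.
  move=> zS; have := mul_restrict_mx v 0 (enum_rank_in xS z).
  rewrite enum_rankK_in // => <-.
  rewrite -mulmxA -row_mul CE !mxE; congr (nat_of_bool _)%:R.
  by apply: (can_in_eq (enum_rankK_in xS)).
have /eigenspace_sgP vA : (v <= eigenspace (adjmx R G) mu)%MS.
  exact: submxMl.
have sumS z : \sum_(w in S) v 0 (enum_rank w) * sg_entry R w z = sg_entry R x z.
  rewrite (bigD1 x) //= vE // eqxx mul1r big1 ?addr0 // => w /andP[wS nwx].
  by rewrite vE // eq_sym (negPf nwx) mul0r.
have splitS (F : sg_vertex G -> R) :
    \sum_w F w = \sum_(w in S) F w + \sum_(w in ~: S) F w.
  rewrite (bigID (mem S)) /=; congr (_ + _).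
  by apply: eq_bigl => w; rewrite inE.
have vT t : t \in ~: S -> mu * v 0 (enum_rank t) = sg_entry R x t.
  move=> tT; rewrite -vA splitS sumS big1 ?addr0 // => w wT.
  by rewrite sg_entry_nadj ?mulr0 //; apply: indS.
rewrite expr2 -mulrA -(vE y yS) -vA splitS sumS mulrDr mulr_sumr.
by congr (_ + _); apply: eq_bigr => t tT; rewrite mulrA vT.
Qed.

End StarSets.

(** * Star sets for an eigenvalue of square 1 *)

(** The diagonal of the reconstruction identity counts the neighbours. *)
Lemma star_neighbor_unique (R : rcfType) (G : sgraph) (S : {set sg_vertex G})
    (mu : R) :
  mu ^+ 2 = 1 -> independent (~: S) -> #|S| = multiplicity G mu ->
  {in S, forall x, #|[set t in ~: S | sg_adj x t]| = 1%N}.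
Proof.
move=> mu1 indS cardS x xS.
have mu0 : mu != 0 by rewrite -sqrf_eq0 mu1 oner_eq0.
have := star_reconstruction mu0 indS cardS xS xS.
rewrite eqxx mu1 mulr1 sg_entry_nadj ?sg_adj_irr // mulr0 add0r.
under eq_bigr => t _ do rewrite (sg_entryC _ t) sg_entry_sqr.
rewrite -natr_sum => /eqP; rewrite (eqr_nat R 1) => /eqP ->.
rewrite -sum1_card big_mkcond [RHS]big_mkcond /=.
by apply: eq_bigr => t _; rewrite !inE; case: (t \in S); case: sg_adj.
Qed.

(** [p x] is the only neighbour outside [S] of the vertex [x] of [S]. *)
Lemma star_matching (R : rcfType) (G : sgraph) (S : {set sg_vertex G})
    (mu : R) :
  bipartite G -> mu ^+ 2 = 1 -> independent (~: S) ->
  #|S| = multiplicity G mu ->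
  exists p : sg_vertex G -> sg_vertex G,
    [/\ {in S, forall x, p x \notin S},
        {in S &, injective p},
        {in S &, forall x y, ~~ sg_adj x y}
      & forall x t, x \in S -> t \notin S -> sg_adj x t = (t == p x)].
Proof.
move=> [c colP] mu1 indS cardS.
have mu0 : mu != 0 by rewrite -sqrf_eq0 mu1 oner_eq0.
have nbr := star_neighbor_unique mu1 indS cardS.
(* for x in S the choice succeeds, so the default value x is not used *)
pose p x := odflt x [pick t in ~: S | sg_adj x t].
have adjE x t : x \in S -> t \notin S -> sg_adj x t = (t == p x).
  move=> xS tS; have /eqP/cards1P [t0 t0E] := nbr x xS.
  have t0P z : (z \notin S) && sg_adj x z = (z == t0).
    by rewrite -in_set1 -t0E !inE.
  rewrite -[LHS]andTb -tS t0P /p; case: pickP => [z|/(_ t0)].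
    by rewrite !inE t0P /= => /eqP ->.
  by rewrite !inE t0P eqxx.
have pT x : x \in S -> p x \notin S.
  move=> xS; have /eqP/cards1P [t0 /setP/(_ t0)] := nbr x xS.
  rewrite !inE eqxx => /andP[t0S]; rewrite adjE // => /eqP <- //.
have padj x : x \in S -> sg_adj x (p x).
  by move=> xS; rewrite adjE ?pT.
have sumE x y : x \in S -> y \in S ->
    \sum_(t in ~: S) sg_entry R x t * sg_entry R t y
    = sg_entry R x (p x) * sg_entry R (p x) y.
  move=> xS yS; rewrite (bigD1 (p x)) /=; last by rewrite inE pT.
  rewrite big1 ?addr0 // => t /andP[]; rewrite inE => tS tp.
  by rewrite sg_entry_nadj ?mul0r // adjE.
(* off-diagonal entries: N N^T has a single term, nonzero iff p x = p y *)
have adjS x y : x \in S -> y \in S -> x != y -> sg_adj x y = (p x == p y).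
  move=> xS yS /negPf nxy.
  have := star_reconstruction mu0 indS cardS xS yS.
  rewrite nxy mulr0 sumE // => /esym/eqP; rewrite addr_eq0 => /eqP E.
  apply: negb_inj; rewrite -(sg_entry_eq0 R x y) -(mulrI_eq0 _ (mulfI mu0)) E.
  rewrite oppr_eq0 mulf_eq0 !sg_entry_eq0 padj //= sg_adj_sym adjE ?pT //.
have pinj : {in S &, injective p}.
  (* otherwise x, y and p x form a triangle *)
  move=> x y xS yS pxy; apply/eqP/negPn/negP => nxy.
  have := colP x y; rewrite adjS // pxy eqxx => /(_ isT).
  have := colP _ _ (padj x xS); have := colP _ _ (padj y yS); rewrite pxy.
  by case: (c x); case: (c y); case: (c (p y)).
exists p; split=> // x y xS yS.
have [->|nxy] := eqVneq x y; first by rewrite sg_adj_irr.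
by rewrite adjS //; apply: contra nxy => /eqP/pinj ->.
Qed.

(** * Edgeless complements and isomorphisms *)

Lemma sg_order_delete (G : sgraph) (S : {set sg_vertex G}) :
  sg_order (sg_delete S) = #|~: S|.
Proof.
by rewrite /sg_order card_sig; apply: eq_card => x; rewrite !inE.
Qed.

Lemma delete_edgeless (G : sgraph) (S : {set sg_vertex G}) :
  (forall x y : sg_vertex (sg_delete S), ~~ sg_adj x y) <-> independent (~: S).
Proof.
split=> [nadj x y | indS x y].
  by rewrite !inE => xS yS; have := nadj (exist _ x xS) (exist _ y yS).
by apply: indS; rewrite inE; [exact: (valP x) | exact: (valP y)].
Qed.

Lemma isomorphic_sK1P (G : sgraph) s :
  isomorphic G (sK1 s) <->
  sg_order G = s /\ forall x y : sg_vertex G, ~~ sg_adj x y.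
Proof.
have A0 : adjmx int (sK1 s) = 0 by apply/(adjmx_eq0 int (sK1 s)).
have order_sK1 : sg_order (sK1 s) = s by rewrite /sg_order card_ord.
split=> [[e [P [permP E]]] | [oG nadj]].
  split; first by rewrite e.
  apply/(adjmx_eq0 int).
  have uP : P \in unitmx by case/is_perm_mxP: permP => t ->; apply: unitmx_perm.
  apply/(can_inj (castmxK e e)).
  rewrite -[LHS](mulKVmx uP) -[X in P *m X](mulmxK uP).
  rewrite -E A0 mul0mx mulmx0.
  by apply/matrixP => i j; rewrite castmxE !mxE.
exists (etrans oG (esym order_sK1)), 1%:M; split; first exact: is_perm_mx1.
rewrite A0 (iffRL (adjmx_eq0 int G) nadj).
by rewrite mulmx1 invmx1 mul1mx; apply/matrixP => i j; rewrite castmxE !mxE.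
Qed.

(** A bijection of the vertices that preserves edges and signs yields the
    permutation matrix asked for by [isomorphic]. *)
Lemma bijection_isomorphic (G1 G2 : sgraph)
    (phi : sg_vertex G2 -> sg_vertex G1) :
  bijective phi ->
  (forall x y, sg_adj (phi x) (phi y) = sg_adj x y) ->
  (forall x y, sg_neg (phi x) (phi y) = sg_neg x y) ->
  isomorphic G1 G2.
Proof.
move=> bphi adjP negP.
have e : sg_order G1 = sg_order G2 by rewrite /sg_order (bij_eq_card bphi).
pose t (i : 'I_(sg_order G2)) := cast_ord e (enum_rank (phi (enum_val i))).
have t_inj : injective t.
  by move=> i j /cast_ord_inj/enum_rank_inj/(bij_inj bphi)/enum_val_inj.
exists e, (perm_mx (perm t_inj)^-1%g); split; first exact: perm_mx_is_perm.
have -> : invmx (perm_mx (perm t_inj)^-1%g) = perm_mx (perm t_inj)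
    :> 'M[int]_ _.
  rewrite -[RHS](mulmxK (unitmx_perm _ (perm t_inj)^-1%g)).
  by rewrite -perm_mxM mulgV perm_mx1 mul1mx.
rewrite -mulmxA -col_permE -row_permE.
apply/matrixP => i j; rewrite !mxE castmxE mxE !permE /t !cast_ordK !enum_rankK.
by rewrite /sg_entry adjP negP.
Qed.

(** * Perfect matchings with signs *)

Section SignedMatching.
Variables (s : nat) (n : pred 'I_s).

(** The edge between [(i, false)] and [(i, true)] is negative when [n i]. *)
Definition signed_neg : rel ('I_s * bool) := fun x y => matching x y && n x.1.

Fact signed_neg_sym : symmetric signed_neg.
Proof.
move=> x y; rewrite /signed_neg matching_sym /matching.
by case: eqP => //= ->.
Qed.

Fact signed_neg_sub : subrel signed_neg (@matching s).
Proof. by move=> x y /andP[]. Qed.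

(** The perfect matching on ['I_s * bool] with negative edges given by [n]. *)
Definition signed_sK2 : sgraph :=
  SGraph (@matching_sym s) (@matching_irr s) signed_neg_sym signed_neg_sub.

Lemma switching_signed_sK2 : switching_equivalent signed_sK2 (sK2 s).
Proof.
(* switch at the true end of each negative edge *)
pose d : 'rV[int]_(sg_order (sK2 s)) :=
  \row_i (let x : 'I_s * bool := enum_val i in
          if x.2 && n x.1 then -1 else 1).
have dP i : d 0 i = 1 \/ d 0 i = -1.
  by rewrite mxE /=; case: ifP => _; [right | left].
have dd : diag_mx d *m diag_mx d = 1%:M.
  rewrite mulmx_diag; apply/matrixP => i j; rewrite !mxE.
  by congr (_ *+ _) => /=; case: ifP => _; rewrite ?mulrNN mulr1.
exists erefl, d; split=> //; rewrite castmx_id.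
have /mulmx1_unit [ud _] := dd.
have -> : invmx (diag_mx d) = diag_mx d.
  by rewrite -[LHS]mulmx1 -dd mulKmx.
apply/matrixP => i j; rewrite mul_diag_mx mul_mx_diag !mxE.
rewrite /sg_entry /= /signed_neg /norel.
case: (enum_val i) (enum_val j) => [a b] [a' b'] /=.
rewrite /matching /=.
case: (eqVneq a a') => [<-|_] /=; last by rewrite mulr0 mul0r.
by case: b; case: b'; case: (n a).
Qed.

End SignedMatching.

(** * The extremal graph *)

(** The star set consists of the ends [(i, false)].  For [s = 0] there is no
    eigenvalue at all, whence the positivity of [s]. *)
Lemma has_star_complement_sK2 (R : rcfType) s (mu : R) :
  (0 < s)%N -> mu ^+ 2 = 1 -> has_star_complement (sK2 s) (sK1 s) mu.
Proof.
move=> s_gt0 mu1.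
have mu0 : mu != 0 by rewrite -sqrf_eq0 mu1 oner_eq0.
pose S : {set sg_vertex (sK2 s)} := [set x : 'I_s * bool | ~~ x.2].
have indS : independent (~: S).
  move=> [a b] [a' b']; rewrite !inE /= !negbK => -> ->.
  by rewrite /matching /= andbF.
have CS : ~: S = (fun i => (i, true)) @: [set: 'I_s].
  apply/setP => [[a b]]; rewrite !inE negbK /=.
  by apply/idP/imsetP => [->|[? _ [_ ->]]] //; exists a; rewrite ?inE.
have cardC : #|~: S| = s by rewrite CS card_imset ?cardsT ?card_ord // => ? ? [].
have ES : S = (fun i => (i, false)) @: [set: 'I_s].
  apply/setP => [[a b]]; rewrite !inE /=.
  by apply/idP/imsetP => [/negPf ->|[? _ [_ ->]]] //; exists a; rewrite ?inE.
have cardS : #|S| = s by rewrite ES card_imset ?cardsT ?card_ord // => ? ? [].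
have multS : multiplicity (sK2 s) mu = #|S|.
  apply/eqP; rewrite eqn_leq /multiplicity; apply/andP; split.
    by rewrite -(rank_restrict_eigenspace mu0 indS) rank_leq_col.
  (* row (i, false) of V is the eigenvector 1 at (i, false), mu at (i, true) *)
  pose V : 'M[R]_(#|S|, sg_order (sK2 s)) := \matrix_(i, j)
    (let x : 'I_s * bool := enum_val i in let y : 'I_s * bool := enum_val j in
     (x.1 == y.1)%:R * (if y.2 then mu else 1)).
  have VS : V *m restrict_mx R S = 1%:M.
    apply/matrixP => i j; rewrite mul_restrict_mx !mxE enum_rankK.
    rewrite -[i == j](inj_eq enum_val_inj).
    move: (enum_valP i) (enum_valP j).
    case: (enum_val i) (enum_val j) => [a b] [a' b'].
    by rewrite !inE xpair_eqE /= => /negPf -> /negPf ->; rewrite mulr1 andbT.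
  have {1}<- : \rank V = #|S|.
    apply/eqP; rewrite eqn_leq rank_leq_row -{1}(mxrank1 R #|S|) -VS.
    exact: mxrankM_maxl.
  apply: mxrankS; apply/row_subP => i; apply/eigenspace_sgP => [[a b]].
  rewrite (bigD1 (a, ~~ b)) //= big1 ?addr0.
    rewrite !mxE !enum_rankK /= /sg_entry /= /matching /= eqxx /=.
    case: b => /=; rewrite !mulr1; last exact: mulrC.
    by rewrite mulrCA -expr2 mu1 !mulr1.
  move=> [a' b'] /= ne; rewrite sg_entry_nadj ?mulr0 // /= /matching /=.
  apply: contra ne => /andP[/eqP -> ]; rewrite xpair_eqE eqxx.
  by case: b' b => [] [].
have nadj := iffRL (delete_edgeless S) indS.
exists S.
  split=> //.
    rewrite /eigenvalue -mxrank_eq0 -/(multiplicity (sK2 s) mu) multS cardS.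
    by rewrite -lt0n.
  rewrite (iffRL (adjmx_eq0 R _) nadj); apply/eigenvalueP => [[v]].
  rewrite mulmx0 => /esym/eqP; rewrite scaler_eq0 (negPf mu0) => /eqP ->.
  by rewrite eqxx.
by apply/isomorphic_sK1P; split=> //; rewrite sg_order_delete.
Qed.

Lemma bipartite_sK2 s : bipartite (sK2 s).
Proof. by exists snd => x y /andP[]. Qed.

Lemma sg_order_sK2 s : sg_order (sK2 s) = (s + s)%N.
Proof. by rewrite /sg_order card_prod card_ord card_bool muln2 addnn. Qed.

Theorem theorem4p1 (R : rcfType) (s : nat) (mu : R) (B : sgraph)
    (hmax : maximal_bipartite (sK1 s) mu B) (hmu : mu ^+ 2 = 1) :
  switching_isomorphic B (sK2 s).
Proof.
have [bipB [S [_ cardS _] /isomorphic_sK1P [oT nadj]] maxB] := hmax.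
have indS := iffLR (delete_edgeless S) nadj.
have cardT : #|~: S| = s by rewrite -sg_order_delete.
have [p [pT pinj nadjS adjE]] := star_matching bipB hmu indS cardS.
have leSs : (#|S| <= s)%N.
  rewrite -cardT -(card_in_imset pinj); apply: subset_leq_card.
  by apply/subsetP => _ /imsetP[x xS ->]; rewrite inE pT.
have oB : sg_order B = (#|S| + s)%N by rewrite -cardT cardsC.
(* maximality against sK2 s; for s = 0 the bound leSs is enough *)
have cardSs : #|S| = s.
  apply/eqP; rewrite eqn_leq leSs /=.
  case: (posnP s) => [->//|s_gt0].
  have := maxB _ (bipartite_sK2 s) (has_star_complement_sK2 s_gt0 hmu).
  by rewrite sg_order_sK2 oB leq_add2r.
(* f enumerates S, and phi sends (i, false) to f i and (i, true) to its match *)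
pose f (i : 'I_s) : sg_vertex B := enum_val (cast_ord (esym cardSs) i).
have fS i : f i \in S by apply: enum_valP.
have f_inj : injective f by move=> i j /enum_val_inj/cast_ord_inj.
pose phi (x : 'I_s * bool) := if x.2 then p (f x.1) else f x.1.
have phiS x : (phi x \in S) = ~~ x.2.
  by rewrite /phi; case: x.2; rewrite ?fS ?(negPf (pT _ (fS _))).
have phi_inj : injective phi.
  move=> x y exy; have := phiS y; rewrite -exy phiS => /negb_inj; move: exy.
  case: x y => [i b] [j b'] /= + bb'; rewrite bb' /phi /=.
  case: b' {bb'} => [/(pinj _ _ (fS i) (fS j))|] /f_inj -> //.
have phi_bij : bijective phi.
  apply: inj_card_bij => //.
  rewrite -[leqLHS]/(sg_order B) -[leqRHS]/(sg_order (sK2 s)).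
  by rewrite sg_order_sK2 oB cardSs.
have adj_ft i j : sg_adj (f i) (p (f j)) = (i == j).
  rewrite adjE ?fS ?pT ?fS // (inj_in_eq pinj) ?fS // (inj_eq f_inj).
  exact: eq_sym.
pose n i := sg_neg (f i) (p (f i)).
have phi_adj x y : sg_adj (phi x) (phi y) = matching x y.
  case: x y => [i b] [j b']; rewrite /phi /matching /=; case: b; case: b' => /=.
  - by rewrite andbF; apply/negbTE/indS; rewrite inE pT ?fS.
  - by rewrite sg_adj_sym adj_ft andbT eq_sym.
  - by rewrite adj_ft andbT.
  - by rewrite andbF; apply/negbTE/nadjS; apply: fS.
have phi_neg x y : sg_neg (phi x) (phi y) = signed_neg n x y.
  rewrite /signed_neg -phi_adj.
  have [adjxy|nadjxy] := boolP (sg_adj (phi x) (phi y)); last first.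
    by apply: contraNF nadjxy => /sg_neg_sub.
  move: adjxy; rewrite phi_adj; case: x y => [i b] [j b'] /andP[/= /eqP <-].
  by rewrite /phi /n /=; case: b; case: b' => //= _; rewrite sg_neg_sym.
exists (signed_sK2 n); split; last exact: switching_signed_sK2.
exact: (bijection_isomorphic (G2 := signed_sK2 n) phi_bij phi_adj phi_neg).
Qed.
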